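(* Let $S$ be a commutative, cancellative semigroup such that $L(s)$ is finite for all $s \in S$. Then for $m \in \mathcal{A}(S)$: 1. $L(s+m) = L(s) + 1$ for all $s \in S$ if and only if $L(\varphi_S(c)) = L(-m + \varphi_S(c)) + 1$ for all $c \in \mathsf{MinRepl}_m(S)$; and 2. $\ell(s+m) = \ell(s) + 1$ for all $s \in S$ if and only if $\ell(\varphi_S(c)) = \ell(-m + \varphi_S(c)) + 1$ for all $c \in \mathsf{MinRepl}_m(S)$.
   Context: Commutative semigroups are written additively and have an identity $0$; $\mathbb{N}$ contains $0$. A commutative cancellative semigroup $S$ is embedded in its group of differences $\mathsf{gp}(S)=\{a-b\mid a,b\in S\}$, so $s-m$ makes sense there. A unit of $S$ is a $u\in S$ with $-u\in S$; $U(S)$ is the group of units, $S_{\mathrm{red}}=S/U(S)$, $[s]=s+U(S)$, and $s\sim t$ (associates) means $t=s+u$ for some unit $u$. An atom is a nonzero nonunit $s\in S$ such that $s=a+b$ with $a,b\in S$ implies $a$ or $b$ is a unit; $\mathcal{A}(S)$ is the set of atoms. For a set $X$, $\mathbb{N}^X$ denotes the direct sum (finitely supported families) with coordinatewise addition and coordinatewise partial order $\le$; $|c|$ is the sum of the coordinates of $c$. For $X\subseteq\mathcal{A}(S_{\mathrm{red}})$ and $c=(c_a)\in\mathbb{N}^X$ (writing $c_a$ for $c_{[a]}$), $\varphi_S(c)=\sum_{[a]\in X}c_a[a]\in S_{\mathrm{red}}$; $\varphi_S(c)$ also denotes any representative in $S$ of this class (nothing below depends on the choice). For $s\in S$, $\mathsf{Z}(s)=\{c\in\mathbb{N}^{\mathcal{A}(S_{\mathrm{red}})}\mid\varphi_S(c)=[s]\}$.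 If $\mathsf{Z}(s)\ne\emptyset$, $L(s)=\sup\{|c| : c\in\mathsf{Z}(s)\}$ and $\ell(s)=\min\{|c| : c\in\mathsf{Z}(s)\}$. ''$L(s)$ is finite'' includes that $\mathsf{Z}(s)\neq\emptyset$. For $m\in\mathcal{A}(S)$: $\mathsf{Repl}_m(S)=\{c\in\mathbb{N}^{\mathcal{A}(S_{\mathrm{red}})\setminus\{[m]\}}\mid -m+\varphi_S(c)\in S\}$, and $\mathsf{MinRepl}_m(S)$ is the set of minimal elements of $\mathsf{Repl}_m(S)$ under $\le$. *)

(* Defs.v *)
From HB Require Import structures.
From mathcomp Require Import all_boot all_order all_algebra finmap.
From mathcomp Require Import ssrAC.
From mathcomp Require Import generic_quotient boolp classical_sets.
From mathcomp Require Import constructive_ereal.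

Set Implicit Arguments.
Unset Strict Implicit.
Unset Printing Implicit Defensive.

Import Order.TTheory GRing.Theory Num.Theory.
Local Open Scope classical_set_scope.
Local Open Scope ring_scope.
Local Open Scope quotient_scope.

(* A commutative semigroup with identity 0 is an [nmodType]. *)

Definition cancellative (S : nmodType) : Prop := right_injective (@GRing.add S).

Definition semigroup_unit (S : nmodType) (u : S) : Prop := exists v, u + v = 0.

Definition assoc (S : nmodType) (s t : S) : Prop :=
  exists2 u, semigroup_unit u & t = s + u.

Definition atom (S : nmodType) : set S :=
  [set s | [/\ s <> 0, ~ semigroup_unit s &
    forall a b, s = a + b -> semigroup_unit a \/ semigroup_unit b]].

Section Reduced.
Variable S : nmodType.
Implicit Types s t u : S.

Lemma unit0 : semigroup_unit (0 : S).
Proof. by exists 0; rewrite addr0. Qed.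

Lemma unitD u v : semigroup_unit u -> semigroup_unit v -> semigroup_unit (u + v).
Proof. by move=> [u' hu] [v' hv]; exists (u' + v'); rewrite addrACA hu hv addr0. Qed.

Definition assocb : rel S := fun s t => `[< assoc s t >].

Lemma assocb_refl : reflexive assocb.
Proof.
by move=> s; apply/asboolP; exists 0; [exact: unit0 | rewrite addr0].
Qed.

Lemma assocb_trans : transitive assocb.
Proof.
move=> t s r /asboolP[u Uu ->] /asboolP[v Uv ->]; apply/asboolP.
by exists (u + v); [exact: unitD | rewrite addrA].
Qed.

Lemma assocb_sym : symmetric assocb.
Proof.
have sub s t : assocb s t -> assocb t s.
  move=> /asboolP[u [v uv] ->]; apply/asboolP.
  exists v; first by exists u; rewrite addrC.
  by rewrite -addrA uv addr0.
by move=> s t; apply/idP/idP; apply: sub.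
Qed.

Canonical assocb_equiv := EquivRel assocb assocb_refl assocb_sym assocb_trans.

Definition red := {eq_quot assocb}.
HB.instance Definition _ := Choice.on red.
HB.instance Definition _ := Quotient.on red.
HB.instance Definition _ := EqQuotient.on red.

Definition cls (s : S) : red := \pi_red s.

Lemma clsP s t : reflect (assoc s t) (cls s == cls t).
Proof. by rewrite /cls eqmodE; apply: asboolP. Qed.

Definition red_add (x y : red) : red := cls (repr x + repr y).

Lemma red_addE s t : red_add (cls s) (cls t) = cls (s + t).
Proof.
have repr_assoc r : assoc (repr (cls r)) r by apply/clsP; rewrite /cls reprK.
have [u Uu es] := repr_assoc s; have [v Uv et] := repr_assoc t.
apply/eqP/clsP; exists (u + v); first exact: unitD.
by rewrite {1}es {1}et addrACA.
Qed.

Lemma red_clsP (x : red) : exists s, x = cls s.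
Proof. by exists (repr x); rewrite /cls reprK. Qed.

Lemma red_addA : associative red_add.
Proof.
move=> x y z; have [a ->] := red_clsP x; have [b ->] := red_clsP y.
by have [c ->] := red_clsP z; rewrite !red_addE addrA.
Qed.

Lemma red_addC : commutative red_add.
Proof. by move=> x y; rewrite /red_add addrC. Qed.

Lemma red_add0 : left_id (cls 0) red_add.
Proof. by move=> x; have [a ->] := red_clsP x; rewrite red_addE add0r. Qed.

HB.instance Definition _ := GRing.isNmodule.Build red red_addA red_addC red_add0.

Lemma clsD s t : cls (s + t) = cls s + cls t.
Proof. by rewrite [RHS]red_addE. Qed.

Lemma cls0 : cls 0 = 0.
Proof. by []. Qed.

End Reduced.

Section GroupOfDifferences.
Variable S : nmodType.
Implicit Types p q : S * S.

(* The pair (a, b) stands for a - b.  The extra summand k makes this an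
   equivalence on any commutative monoid; cancellation removes it. *)
Definition gp_rel : rel (S * S) :=
  fun p q => `[< exists k, p.1 + q.2 + k = q.1 + p.2 + k >].

Lemma gp_rel_refl : reflexive gp_rel.
Proof. by move=> p; apply/asboolP; exists 0. Qed.

Lemma gp_rel_sym : symmetric gp_rel.
Proof.
have sub p q : gp_rel p q -> gp_rel q p.
  by move=> /asboolP[k e]; apply/asboolP; exists k.
by move=> p q; apply/idP/idP; apply: sub.
Qed.

Lemma gp_rel_trans : transitive gp_rel.
Proof.
move=> [c d] [a b] [e f] /asboolP[k /= h1] /asboolP[l /= h2]; apply/asboolP.
exists (c + d + k + l) => /=.
have -> : a + f + (c + d + k + l) = (a + d + k) + (c + f + l).
  by rewrite (AC (2*4) ((1*4*5)*(3*2*6)))/=.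
rewrite h1 h2.
by rewrite (AC (3*3) ((4*2)*(1*5*3*6)))/=.
Qed.

Canonical gp_rel_equiv := EquivRel gp_rel gp_rel_refl gp_rel_sym gp_rel_trans.

Definition gp := {eq_quot gp_rel}.
HB.instance Definition _ := Choice.on gp.
HB.instance Definition _ := Quotient.on gp.
HB.instance Definition _ := EqQuotient.on gp.

Definition diff (p : S * S) : gp := \pi_gp p.

Lemma diffP p q :
  reflect (exists k, p.1 + q.2 + k = q.1 + p.2 + k) (diff p == diff q).
Proof. by rewrite /diff eqmodE; apply: asboolP. Qed.

Definition gp_add (x y : gp) : gp :=
  diff ((repr x).1 + (repr y).1, (repr x).2 + (repr y).2).

Definition gp_opp (x : gp) : gp := diff ((repr x).2, (repr x).1).

Lemma repr_diff p :
  exists k, (repr (diff p)).1 + p.2 + k = p.1 + (repr (diff p)).2 + k.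
Proof. by apply/diffP; rewrite /diff reprK. Qed.

Lemma gp_addE p q : gp_add (diff p) (diff q) = diff (p.1 + q.1, p.2 + q.2).
Proof.
have [k hk] := repr_diff p; have [l hl] := repr_diff q.
apply/eqP/diffP; exists (k + l) => /=.
rewrite (AC ((2*2)*2) (((1*3)*5)*((2*4)*6)))/= hk hl.
by rewrite (AC (3*3) ((1*4)*(2*5)*(3*6)))/=.
Qed.

Lemma gp_oppE p : gp_opp (diff p) = diff (p.2, p.1).
Proof.
have [k hk] := repr_diff p; apply/eqP/diffP; exists k => /=.
by rewrite [_ + p.1]addrC [p.2 + _]addrC.
Qed.

Lemma gp_diffP (x : gp) : exists p, x = diff p.
Proof. by exists (repr x); rewrite /diff reprK. Qed.

Lemma gp_addA : associative gp_add.
Proof.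
move=> x y z; have [a ->] := gp_diffP x; have [b ->] := gp_diffP y.
by have [c ->] := gp_diffP z; rewrite !gp_addE /= !addrA.
Qed.

Lemma gp_addC : commutative gp_add.
Proof.
move=> x y; rewrite /gp_add; congr (diff (_, _)); exact: addrC.
Qed.

Lemma gp_add0 : left_id (diff (0, 0)) gp_add.
Proof.
by move=> x; have [[a b] ->] := gp_diffP x; rewrite gp_addE /= !add0r.
Qed.

Lemma gp_addN : left_inverse (diff (0, 0)) gp_opp gp_add.
Proof.
move=> x; have [[a b] ->] := gp_diffP x; rewrite gp_oppE gp_addE /=.
by apply/eqP/diffP; exists 0 => /=; rewrite !addr0 add0r addrC.
Qed.

HB.instance Definition _ :=
  GRing.isZmodule.Build gp gp_addA gp_addC gp_add0 gp_addN.

(* The canonical map s |-> s - 0, injective when S is cancellative. *)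
Definition to_gp (s : S) : gp := diff (s, 0).

Lemma to_gpD (s t : S) : to_gp (s + t) = to_gp s + to_gp t.
Proof. by rewrite [RHS]gp_addE /= addr0. Qed.

Lemma to_gp_inj : cancellative S -> injective to_gp.
Proof.
move=> cS s t /eqP/diffP[k] /=; rewrite !addr0 => e.
by apply: (cS k); rewrite /= ![k + _]addrC.
Qed.

Lemma gpE (x : gp) : exists a b, x = to_gp a - to_gp b.
Proof.
have [[a b] ->] := gp_diffP x; exists a, b.
by rewrite [- _]gp_oppE [RHS]gp_addE /= addr0 add0r.
Qed.

End GroupOfDifferences.

(* Elements of N^X, for X a subset of T, are the finitely supported functions
   T -> nat whose support lies in X; so N^X is included in N^Y when X is
   included in Y. *)
Notation fsnat T := {fsfun T -> nat with 0%N}.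

Definition families (T : choiceType) (X : set T) : set (fsnat T) :=
  [set c | forall x, x \in finsupp c -> X x].

Definition fam_le (T : choiceType) (c d : fsnat T) : Prop :=
  forall x, (c x <= d x)%N.

Definition fam_size (T : choiceType) (c : fsnat T) : nat :=
  (\sum_(x <- finsupp c) c x)%N.

Section Factorizations.
Variable S : nmodType.
Implicit Types (s m r t : S) (c d : fsnat (red S)).

Definition phi c : red S := \sum_(x <- finsupp c) x *+ c x.

Definition fact s : set (fsnat (red S)) :=
  families (@atom (red S)) `&` [set c | phi c = cls s].

(* The supremum is taken in the extended integers, so that it is +oo when the
   lengths are unbounded (and -oo when there is no factorization). *)
Definition maxlen s : \bar int :=
  supremum -oo%E [set (Posz (fam_size c))%:E | c in fact s].

Definition maxlen_finite s : Prop :=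
  fact s !=set0 /\ maxlen s \is a fin_num.

(* The junk value 0 is only used when there is no factorization. *)
Definition minlen s : nat :=
  let lengths := [set fam_size c | c in fact s] in
  xget 0%N (lengths `&` lbound lengths).

(* [sub_eq m c r t] says that r represents phi c in S and that the element
   -m + r of gp(S) is (the image of) t. *)
Definition sub_eq m c r t : Prop :=
  cls r = phi c /\ - to_gp m + to_gp r = to_gp t.

Definition Repl m : set (fsnat (red S)) :=
  families (@atom (red S) `\ cls m) `&`
  [set c | exists r t, sub_eq m c r t].

Definition MinRepl m : set (fsnat (red S)) :=
  [set c | Repl m c /\ forall d, Repl m d -> fam_le d c -> d = c].

End Factorizations.

(* Main.v *)
(** For an atom [m], [L(s + m) >= L(s) + 1] and [l(s + m) <= l(s) + 1] always
    hold.  For the reverse inequalities take an extremal factorization [z] of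
    [s + m].  If [z] involves [m], remove it.  Otherwise [z] lies in [Repl_m],
    hence above some minimal [c]; writing [z = c + d], the element [s] is
    associated to [(-m + phi c) + phi d], so an extremal factorization of
    [-m + phi c] extends by [d] to a factorization of [s], and the hypothesis
    compares its length with [|c| + |d| - 1]. *)
Require Import Defs.
From mathcomp Require Import all_boot all_order all_algebra finmap.
From mathcomp Require Import boolp classical_sets constructive_ereal.
From mathcomp Require Import zify.

Set Implicit Arguments.
Unset Strict Implicit.
Unset Printing Implicit Defensive.

Import Order.TTheory GRing.Theory Num.Theory.
Local Open Scope fset_scope.
Local Open Scope ring_scope.

(** * Arithmetic and order of finitely supported families *)

Section Families.
Variable T : choiceType.
Implicit Types (c d z : fsnat T) (x : T).

Definition fam_add c d : fsnat T :=
  [fsfun x in finsupp c `|` finsupp d => (c x + d x)%N].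

Definition fam_sub c d : fsnat T := [fsfun x in finsupp c => (c x - d x)%N].

Definition fam_single x : fsnat T := [fsfun y in [fset x] => 1%N].

Lemma fam_addE c d x : fam_add c d x = (c x + d x)%N.
Proof.
rewrite fsfunE in_fsetU !mem_finsupp.
by case: eqP => [->|//]; case: eqP => [->|].
Qed.

Lemma fam_subE c d x : fam_sub c d x = (c x - d x)%N.
Proof. by rewrite fsfunE mem_finsupp; case: eqP => [->|]. Qed.

Lemma fam_singleE x y : fam_single x y = (y == x).
Proof. by rewrite fsfunE in_fset1; case: eqP. Qed.

Lemma fam_subK c d : fam_le d c -> fam_add d (fam_sub c d) = c.
Proof. by move=> dc; apply/fsfunP => x; rewrite fam_addE fam_subE subnKC. Qed.

Lemma fam_le_single z x : x \in finsupp z -> fam_le (fam_single x) z.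
Proof.
rewrite mem_finsupp -lt0n => zx y; rewrite fam_singleE.
by case: eqP => [->|].
Qed.

Lemma families_le (X : set T) c d : fam_le d c -> families X c -> families X d.
Proof.
move=> dc Xc x xd; apply: Xc; move: xd (dc x); rewrite !mem_finsupp; lia.
Qed.

Lemma families_add (X : set T) c d :
  families X c -> families X d -> families X (fam_add c d).
Proof.
move=> Xc Xd x; rewrite mem_finsupp fam_addE addn_eq0 negb_and.
by case/orP => h; [apply: Xc | apply: Xd]; rewrite mem_finsupp.
Qed.

Lemma families_sub (X : set T) c d : families X c -> families X (fam_sub c d).
Proof. by apply: families_le => x; rewrite fam_subE leq_subr. Qed.

Lemma families_single (X : set T) x : X x -> families X (fam_single x).
Proof. by move=> Xx y; rewrite mem_finsupp fam_singleE; case: (y =P x) => [->|]. Qed.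

(** Common form of [phi] ([f] the identity) and [fam_size] ([f] constantly 1), so that additivity is
    proved once for both. *)
Definition fam_eval (V : nmodType) (f : T -> V) c : V :=
  \sum_(x <- finsupp c) f x *+ c x.

(** Coordinates off the support contribute 0; this brings sums over different supports to a common
    index set. *)
Lemma fam_eval_widen (V : nmodType) (f : T -> V) (A : {fset T}) c :
  finsupp c `<=` A -> fam_eval f c = \sum_(x <- A) f x *+ c x.
Proof.
move=> cA; apply: big_fset_incl => // x _ xc.
by rewrite fsfun_dflt ?mulr0n.
Qed.

Lemma fam_evalD (V : nmodType) (f : T -> V) c d :
  fam_eval f (fam_add c d) = fam_eval f c + fam_eval f d.
Proof.
rewrite (@fam_eval_widen _ _ (finsupp c `|` finsupp d)); last first.
  by apply/fsubsetP => x; rewrite in_fsetU !mem_finsupp fam_addE; lia.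
rewrite (fam_eval_widen f (fsubsetUl (finsupp c) (finsupp d))).
rewrite (fam_eval_widen f (fsubsetUr (finsupp c) (finsupp d))).
by rewrite -big_split; apply: eq_bigr => x _; rewrite fam_addE mulrnDr.
Qed.

Lemma fam_eval_single (V : nmodType) (f : T -> V) x :
  fam_eval f (fam_single x) = f x.
Proof.
rewrite (@fam_eval_widen _ _ [fset x]); last first.
  by apply/fsubsetP => y; rewrite mem_finsupp fam_singleE in_fset1; case: (y =P x).
by rewrite big_seq_fset1 fam_singleE eqxx.
Qed.

Lemma fam_sizeE c : fam_size c = fam_eval (fun=> 1%N) c.
Proof. by apply: eq_bigr => x _; rewrite natn. Qed.

Lemma fam_sizeD c d : fam_size (fam_add c d) = (fam_size c + fam_size d)%N.
Proof. by rewrite !fam_sizeE fam_evalD. Qed.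

Lemma fam_size_single x : fam_size (fam_single x) = 1%N.
Proof. by rewrite fam_sizeE fam_eval_single. Qed.

Lemma fam_size_lt c d : fam_le d c -> d <> c -> (fam_size d < fam_size c)%N.
Proof.
move=> dc neq; rewrite -(fam_subK dc) fam_sizeD -[ltnLHS]addn0 ltn_add2l.
rewrite lt0n; apply/eqP => /eqP; rewrite sum_nat_seq_eq0 => /allP sz.
apply: neq; apply/fsfunP => x; apply/eqP; rewrite eqn_leq dc /=.
rewrite -subn_eq0 -fam_subE.
case: (boolP (x \in finsupp (fam_sub c d))) => [/sz //|/fsfun_dflt -> //].
Qed.

(** Strong induction on size: passing to a strictly smaller family lowers [fam_size], so the descent
    stops at a minimal one. *)
Lemma exists_minimal_family (P : set (fsnat T)) z : P z ->
  exists c, [/\ P c, fam_le c z & forall d, P d -> fam_le d c -> d = c].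
Proof.
have [n] := ubnP (fam_size z); elim: n z => // n IH z sz Pz.
case: (pselect (exists d, [/\ P d, fam_le d z & d <> z])) => [[d [Pd dz neq]]|none].
  have [|c [Pc cd minc]] := IH d _ Pd.
    by have := fam_size_lt dz neq; lia.
  by exists c; split=> // x; apply: leq_trans (cd x) (dz x).
exists z; split=> // d Pd dz; apply: contrapT => neq; apply: none.
by exists d.
Qed.

End Families.

(** * Units and atoms of the reduced semigroup *)

Section ReducedAtoms.
Variable S : nmodType.
Implicit Types s t a b : S.

Lemma unit_addl a b : semigroup_unit (a + b) -> semigroup_unit a.
Proof. by move=> [v e]; exists (b + v); rewrite addrA. Qed.

Lemma unit_addr a b : semigroup_unit (a + b) -> semigroup_unit b.
Proof. by rewrite addrC; apply: unit_addl. Qed.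

Lemma clsE s t : (cls s = cls t) <-> assoc s t.
Proof. by split=> [e|h]; [apply/clsP/eqP|apply/eqP/clsP]. Qed.

Lemma cls_eq0 s : (cls s = 0) <-> semigroup_unit s.
Proof.
rewrite -cls0; split=> [/esym/clsE[u Uu ->]|Us]; first by rewrite add0r.
by apply/esym/clsE; exists s; rewrite ?add0r.
Qed.

Lemma red_unitE s : semigroup_unit (cls s) <-> semigroup_unit s.
Proof.
split=> [[y]|/cls_eq0 ->]; last exact: unit0.
have [t ->] := red_clsP y; rewrite -clsD => /cls_eq0; exact: unit_addl.
Qed.

Lemma atom_cls m : atom m -> @atom (red S) (cls m).
Proof.
move=> [m0 mU mirr]; split; [by move/cls_eq0|by move/red_unitE|].
move=> x y; have [a ->] := red_clsP x; have [b ->] := red_clsP y.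
(* Lifting to [S] gives [m = a + (b + u)] with [u] a unit, a splitting to which irreducibility of
   [m] applies. *)
rewrite -clsD => /esym/clsE[u Uu]; rewrite -addrA => /mirr[Ua|Ubu].
  by left; apply/red_unitE.
by right; apply/red_unitE; apply: unit_addl Ubu.
Qed.

End ReducedAtoms.

(** * Factorizations of [s + m] in a cancellative semigroup *)

Section Cancellation.
Variable S : nmodType.
Hypothesis S_canc : cancellative S.
Implicit Types (m r s t : S) (c d z : fsnat (red S)).

Lemma cls_addI m s t : cls (m + s) = cls (m + t) -> cls s = cls t.
Proof.
by move=> /clsE[u Uu]; rewrite -addrA => /S_canc e; apply/clsE; exists u.
Qed.

(** Injectivity of [to_gp] pulls the identity in the group of differences back to [S], where all
    later arguments take place. *)
Lemma sub_eqE m c r t : sub_eq m c r t <-> cls r = phi c /\ r = m + t.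
Proof.
split=> -[h e]; split=> //; last by rewrite e to_gpD addKr.
by apply: (to_gp_inj S_canc); rewrite to_gpD -e addNKr.
Qed.

Lemma phiD c d : phi (fam_add c d) = phi c + phi d.
Proof. exact: (fam_evalD id). Qed.

Lemma phi_single (x : red S) : phi (fam_single x) = x.
Proof. exact: (fam_eval_single id). Qed.

(** Applied in two ways: with [d] the single atom [cls m], and with [d] the remainder of a
    factorization above a minimal replacement. *)
Lemma fact_add s t c d : fact t c -> families (@atom (red S)) d ->
  cls s = cls t + phi d -> fact s (fam_add c d).
Proof.
move=> [Ac pc] Ad es; split; first exact: families_add.
by rewrite /= phiD pc es.
Qed.

Lemma fact_add_atom m s z : atom m -> fact s z ->
  fact (s + m) (fam_add z (fam_single (cls m))).
Proof.
move=> am fz; apply: (fact_add fz); last by rewrite phi_single clsD.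
exact: families_single (atom_cls am).
Qed.

(** Each case records the size of [z], so that the arguments for longest and shortest factorizations
    share one case analysis. *)
Variant fact_add_atom_spec m s z : Prop :=
  | FactRemoveAtom z' of fact s z' & fam_size z = (fam_size z').+1
  | FactReplace c d r t of MinRepl m c & sub_eq m c r t & fact r c &
      families (@atom (red S)) d & cls s = cls t + phi d &
      fam_size z = (fam_size c + fam_size d)%N.

Lemma fact_add_atomP m s z : fact (s + m) z -> fact_add_atom_spec m s z.
Proof.
move=> [Az pz]; case: (boolP (cls m \in finsupp z)) => mz.
  have zE := fam_subK (fam_le_single mz).
  apply: (@FactRemoveAtom _ _ _ (fam_sub z (fam_single (cls m)))).
    split; first exact: families_sub.
    have [q /= qE] := red_clsP (phi (fam_sub z (fam_single (cls m)))).
    move: pz; rewrite /= -{1}zE phiD phi_single qE -clsD [s + m]addrC.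
    exact: cls_addI.
  by rewrite -{1}zE fam_sizeD fam_size_single.
(* As [z] avoids [cls m], it is itself a replacement, with [-m + (s + m) = s]. *)
have Rz : Repl m z.
  split=> [x xz|]; first by split; [exact: Az|move=> xm; rewrite -xm xz in mz].
  by exists (s + m), s; apply/sub_eqE; split; last exact: addrC.
have [c [Rc cz minc]] := exists_minimal_family Rz.
have [_ [r [t rt]]] := Rc; have [rc rE] := (sub_eqE _ _ _ _).1 rt.
have zE := fam_subK cz.
apply: (@FactReplace _ _ _ c (fam_sub z c) r t) => //.
- by split; [exact: families_le Az|].
- exact: families_sub.
- have [q qE] := red_clsP (phi (fam_sub z c)); rewrite qE -clsD.
  (* After adding [m], both sides equal [phi z], because [r = m + t] represents [phi c]. *)
  apply: (@cls_addI m); move: pz.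
  by rewrite /= -zE phiD -rc rE qE -clsD -addrA [s + m]addrC => ->.
- by rewrite -{1}zE fam_sizeD.
Qed.

End Cancellation.

(** * Extremal lengths are attained *)

Section Lengths.
Variable S : nmodType.
Implicit Types (s : S) (z : fsnat (red S)).

Lemma maxlenP s : maxlen_finite s -> exists2 n : nat,
  maxlen s = (Posz n)%:E & (exists2 z, fact s z & fam_size z = n) /\
    forall z, fact s z -> (fam_size z <= n)%N.
Proof.
move=> [[z0 fz0]]; rewrite /maxlen /supremum.
case: ifPn => [/eqP e|_].
  suff: (set0 : set (\bar int)) (Posz (fam_size z0))%:E by [].
  by rewrite -e; exists z0.
case: xgetP => [[k| |] // _ [ubk lubk] _|//].
(* A finite supremum of integers is attained: otherwise [k - 1] would still be an upper bound. *)
have [z fz zk] : exists2 z, fact s z & Posz (fam_size z) = k.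
  apply: contrapT => none.
  suff: (k%:E <= (k - 1)%:E)%E by rewrite lee_fin; lia.
  apply: lubk => _ [z fz <-]; rewrite lee_fin.
  have : ((Posz (fam_size z))%:E <= k%:E)%E by apply: ubk; exists z.
  have : Posz (fam_size z) <> k by move=> zk; apply: none; exists z.
  rewrite lee_fin; lia.
exists (fam_size z); first by rewrite zk.
split; first by exists z.
move=> z' fz'; have : ((Posz (fam_size z'))%:E <= k%:E)%E.
  by apply: ubk; exists z'.
by rewrite lee_fin -zk lez_nat.
Qed.

Lemma minlenP s : maxlen_finite s ->
  (exists2 z, fact s z & fam_size z = minlen s) /\
    forall z, fact s z -> (minlen s <= fam_size z)%N.
Proof.
move=> [[z0 fz0] _]; rewrite /minlen /=.
case: xgetP => [_ -> [[z fz <-] lb]|none].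
  by split=> [|z' fz']; [exists z|apply: lb; exists z'].
(* The default branch of [xget] is contradictory: the well-ordering of the naturals supplies a least
   length. *)
have ex : exists n, `[< exists2 z, fact s z & fam_size z = n >].
  by exists (fam_size z0); apply/asboolP; exists z0.
case: (none (ex_minn ex)); case: ex_minnP => n /asboolP[z fz <-] nmin.
split; first by exists z.
by move=> _ [z' fz' <-]; apply: nmin; apply/asboolP; exists z'.
Qed.

End Lengths.

Theorem theorem2p5 (S : nmodType) (S_canc : cancellative S)
    (L_fin : forall s : S, maxlen_finite s) (m : S) (m_atom : atom m) :
  ((forall s : S, maxlen (s + m) = (maxlen s + 1)%E) <->
   (forall c, MinRepl m c -> forall r t : S, sub_eq m c r t ->
      maxlen r = (maxlen t + 1)%E)) /\
  ((forall s : S, minlen (s + m) = (minlen s + 1)%N) <->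
   (forall c, MinRepl m c -> forall r t : S, sub_eq m c r t ->
      minlen r = (minlen t + 1)%N)).
Proof.
(* The forward implications are the hypothesis at [t], since [r = m + t]. *)
split; split=> [H c _ r t /(sub_eqE S_canc)[_ ->]|H s]; try by rewrite addrC H.
- have [k -> [[z fz zk] maxk]] := maxlenP (L_fin (s + m)).
  have [l -> [[y fy yl] maxl]] := maxlenP (L_fin s).
  rewrite -EFinD -[1]/(Posz 1) -PoszD; congr (Posz _)%:E.
  apply/eqP; rewrite eqn_leq andbC; apply/andP; split.
    have := maxk _ (fact_add_atom m_atom fy).
    by rewrite fam_sizeD fam_size_single yl.
  rewrite -zk; case: (fact_add_atomP S_canc fz) => [z' fz' ->|].
    by rewrite addn1 ltnS maxl.
  move=> c d r t minc rt fc Ad es ->.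
  (* With [w] a longest factorization of [t]: [|c| + |d| <= L(r) + |d| = |w| + 1 + |d| <= L(s) +
     1]. *)
  have := H _ minc _ _ rt; have [n -> [_ maxr]] := maxlenP (L_fin r).
  have [p -> [[w fw <-] _]] := maxlenP (L_fin t).
  rewrite -EFinD -[1]/(Posz 1) -PoszD => -[np]; have := maxr _ fc.
  by have := maxl _ (fact_add fw Ad es); rewrite fam_sizeD; lia.
- have [[z fz zk] mink] := minlenP (L_fin (s + m)).
  have [[y fy yl] minl] := minlenP (L_fin s).
  apply/eqP; rewrite eqn_leq; apply/andP; split.
    have := mink _ (fact_add_atom m_atom fy).
    by rewrite fam_sizeD fam_size_single yl.
  rewrite -zk; case: (fact_add_atomP S_canc fz) => [z' fz' ->|].
    by rewrite addn1 ltnS minl.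
  move=> c d r t minc rt fc Ad es ->.
  (* The same chain reversed, with [w] a shortest factorization of [t]: [|c| + |d| >= l(r) + |d| =
     |w| + 1 + |d| >= l(s) + 1]. *)
  have [_ minr] := minlenP (L_fin r); have := minr _ fc.
  rewrite (H _ minc _ _ rt); have [[w fw <-] _] := minlenP (L_fin t).
  by have := minl _ (fact_add fw Ad es); rewrite fam_sizeD; lia.
Qed.
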